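(* The following properties can be expressed in two-variable dependence logic $\mathsf{D}^2$: (a) For unary relation symbols $P$ and $Q$, there is a $\mathsf{D}^2$-sentence $\phi$ such that for every structure $\mathfrak{A}$ interpreting $P,Q$: $\mathfrak{A}\models\phi$ iff $|P^{\mathfrak{A}}|=|Q^{\mathfrak{A}}|$. In particular $\mathsf{D}^2\not\le\mathsf{FO}$, i.e. not every $\mathsf{D}^2$-sentence is equivalent to a first-order sentence. (b) If the vocabulary contains a constant symbol $c$, there is a $\mathsf{D}^2$-sentence $\psi$ (in which the constant $c$ may be used as a term) such that for every structure $\mathfrak{A}$ of that vocabulary: $\mathfrak{A}\models\psi$ iff the domain $A$ of $\mathfrak{A}$ is infinite. (c) For each positive integer $k$, there is a sentence $\theta$ of $\mathsf{D}^1$ such that for every structure $\mathfrak{A}$ with domain $A$: $\mathfrak{A}\models\theta$ iff $|A|\le k$.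
   Context: Syntax. Fix two variables $x,y$. Formulas of $\mathsf{D}^2(\tau)$ are generated by $\phi::= t_1=t_2\mid R(t_1,\dots,t_n)\mid \neg t_1=t_2\mid \neg R(t_1,\dots,t_n)\mid =\!(t_1,t_2)\mid \neg =\!(t_1,t_2)\mid =\!(t_1)\mid\neg =\!(t_1)\mid(\phi\wedge\phi)\mid(\phi\vee\phi)\mid\forall x\phi\mid\forall y\phi\mid\exists x\phi\mid\exists y\phi$, where $R\in\tau$ is $n$-ary and the terms $t_i$ are variables in $\{x,y\}$ (or, in part (b), the constant $c$). $\mathsf{D}^1$ is the fragment in which only one variable $x$ occurs. A sentence is a formula without free variables, where the free variables of $=\!(t_1,\dots,t_n)$ are all variables occurring in it and otherwise free variables are as in first-order logic. Teams. Structures have nonempty domains. A team $X$ of $\mathfrak{A}$ (domain $A$) with domain $\mathrm{dom}(X)=\{x_1,\dots,x_k\}$ (possibly empty) is any set of assignments $\{x_1,\dots,x_k\}\to A$. The assignment $s(a/x)$ has domain $\mathrm{dom}(s)\cup\{x\}$, maps $x$ to $a$ and agrees with $s$ elsewhere. For $F\colon X\to A$, $X(F/x)=\{s(F(s)/x)\mid s\in X\}$, and $X(A/x)=\{s(a/x)\mid s\in X,a\in A\}$. Semantics (the domain of $X$ contains the free variables of the formula). (1) For a first-order literal $\phi$: $\mathfrak{A}\models_X\phi$ iff every $s\in X$ satisfies $\phi$ in $\mathfrak{A}$ in the usual sense. (2) $\mathfrak{A}\models_X\psi\wedge\phi$ iff $\mathfrak{A}\models_X\psi$ and $\mathfrak{A}\models_X\phi$.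 (3) $\mathfrak{A}\models_X\psi\vee\phi$ iff $X=Y\cup Z$ for some teams $Y,Z$ with $\mathfrak{A}\models_Y\psi$ and $\mathfrak{A}\models_Z\phi$. (4) $\mathfrak{A}\models_X\exists v\psi$ iff $\mathfrak{A}\models_{X(F/v)}\psi$ for some $F\colon X\to A$. (5) $\mathfrak{A}\models_X\forall v\psi$ iff $\mathfrak{A}\models_{X(A/v)}\psi$. (6) $\mathfrak{A}\models_X{=}(t_1,\dots,t_n)$ iff any $s,s'\in X$ that give equal values to each of $t_1,\dots,t_{n-1}$ give equal values to $t_n$. (7) $\mathfrak{A}\models_X\neg{=}(t_1,\dots,t_n)$ iff $X=\emptyset$. A sentence $\phi$ is true in $\mathfrak{A}$, $\mathfrak{A}\models\phi$, if $\mathfrak{A}\models_{\{\emptyset\}}\phi$, where $\{\emptyset\}$ is the team consisting of the empty assignment. *)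

(* Defs.v *)
From mathcomp Require Import all_boot.
From mathcomp Require Import classical_sets cardinality.

Set Implicit Arguments.
Unset Strict Implicit.
Unset Printing Implicit Defensive.

Local Open Scope classical_set_scope.

Record vocabulary := Vocabulary {
  rel_symb : Type;
  arity : rel_symb -> nat;
  const_symb : Type
}.

Record structure (tau : vocabulary) := Structure {
  dom :> Type;
  dom_inhabited : inhabited dom;
  rel_interp : forall R : rel_symb tau, ('I_(arity R) -> dom) -> Prop;
  const_interp : const_symb tau -> dom
}.

(* For arity 1 the constant function with value a is the 1-tuple (a). *)
Definition unary_ext tau (A : structure tau) (P : rel_symb tau) : set A :=
  [set a : A | rel_interp (fun _ : 'I_(arity P) => a)].
Arguments unary_ext {tau} A P.

Inductive term (tau : vocabulary) (V : Type) :=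
  | Var of V
  | Const of const_symb tau.
Arguments Var {tau V}.
Arguments Const {tau V}.

Definition term_fv tau V (t : term tau V) : set V :=
  match t with Var v => [set v] | Const _ => set0 end.

Inductive var := vx | vy.

Definition same_var (v w : var) : bool :=
  match v, w with vx, vx | vy, vy => true | _, _ => false end.

(* All constants of tau are admitted as terms here; the fragments [in_D2],
   [in_D2_with] and [in_D1] below say which symbols may actually occur. *)
Inductive formula (tau : vocabulary) :=
  | Eq of term tau var & term tau var
  | Rel (R : rel_symb tau) of ('I_(arity R) -> term tau var)
  | NEq of term tau var & term tau var
  | NRel (R : rel_symb tau) of ('I_(arity R) -> term tau var)
  | Dep2 of term tau var & term tau var
  | NDep2 of term tau var & term tau var
  | Dep1 of term tau var
  | NDep1 of term tau var
  | And of formula tau & formula tau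
  | Or of formula tau & formula tau
  | All of var & formula tau
  | Ex of var & formula tau.

Fixpoint fv tau (phi : formula tau) : set var :=
  match phi with
  | Eq t u | NEq t u | Dep2 t u | NDep2 t u => term_fv t `|` term_fv u
  | Rel _ ts | NRel _ ts => \bigcup_i term_fv (ts i)
  | Dep1 t | NDep1 t => term_fv t
  | And psi chi | Or psi chi => fv psi `|` fv chi
  | All v psi | Ex v psi => fv psi `\ v
  end.

Definition sentence tau (phi : formula tau) : Prop := fv phi = set0.

Definition term_symbols_in tau (V : set var) (K : set (const_symb tau))
    (t : term tau var) : Prop :=
  match t with Var v => V v | Const c => K c end.

(* Only variables in V (free, bound or quantified) and constants in K occur. *)
Fixpoint symbols_in tau (V : set var) (K : set (const_symb tau))
    (phi : formula tau) : Prop :=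
  match phi with
  | Eq t u | NEq t u | Dep2 t u | NDep2 t u => term_symbols_in V K t /\ term_symbols_in V K u
  | Rel _ ts | NRel _ ts => forall i, term_symbols_in V K (ts i)
  | Dep1 t | NDep1 t => term_symbols_in V K t
  | And psi chi | Or psi chi => symbols_in V K psi /\ symbols_in V K chi
  | All v psi | Ex v psi => V v /\ symbols_in V K psi
  end.

Definition in_D2 tau (phi : formula tau) : Prop := symbols_in setT set0 phi.

Definition in_D2_with tau (c : const_symb tau) (phi : formula tau) : Prop :=
  symbols_in setT [set c] phi.

Definition in_D1 tau (phi : formula tau) : Prop := symbols_in [set vx] set0 phi.

(* Assignments are partial functions, None meaning "outside the domain".
   A team with domain D is a set of assignments that all have domain D. Every
   team reached when evaluating a sentence on the team {empty assignment} has
   a common domain, which contains the free variables of the subformula under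
   evaluation, so the clauses below never meet an undefined term value. *)
Definition assignment (A : Type) := var -> option A.

Definition empty_assignment A : assignment A := fun _ => None.

Definition update A (s : assignment A) (v : var) (a : A) : assignment A :=
  fun w => if same_var v w then Some a else s w.

Definition team (A : Type) := set (assignment A).

Definition supplement A (X : team A) (v : var) (F : set_type X -> A) : team A :=
  range (fun s : set_type X => update (val s) v (F s)).

Definition duplicate A (X : team A) (v : var) : team A :=
  [set s' | exists s a, X s /\ s' = update s v a].

Section TeamSemantics.
Variables (tau : vocabulary) (A : structure tau).

Definition term_val (s : assignment A) (t : term tau var) : option A :=
  match t with Var v => s v | Const c => Some (const_interp A c) end.

Fixpoint team_sat (X : team A) (phi : formula tau) : Prop :=
  match phi with
  | Eq t u => forall s, X s -> term_val s t = term_val s u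
  | NEq t u => forall s, X s -> term_val s t <> term_val s u
  | Rel R ts => forall s, X s ->
      exists2 a : 'I_(arity R) -> A,
        forall i, term_val s (ts i) = Some (a i) & rel_interp a
  | NRel R ts => forall s, X s ->
      exists2 a : 'I_(arity R) -> A,
        forall i, term_val s (ts i) = Some (a i) & ~ rel_interp a
  | Dep2 t u => forall s s', X s -> X s' ->
      term_val s t = term_val s' t -> term_val s u = term_val s' u
  | Dep1 t => forall s s', X s -> X s' -> term_val s t = term_val s' t
  | NDep2 _ _ | NDep1 _ => X = set0
  | And psi chi => team_sat X psi /\ team_sat X chi
  | Or psi chi => exists Y Z : team A,
      [/\ X = Y `|` Z, team_sat Y psi & team_sat Z chi]
  | Ex v psi => exists F : set_type X -> A, team_sat (supplement v F) psi
  | All v psi => team_sat (duplicate X v) psi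
  end.

Definition models (phi : formula tau) : Prop :=
  team_sat [set @empty_assignment A] phi.

End TeamSemantics.

Inductive fo_formula (tau : vocabulary) :=
  | FoEq of term tau nat & term tau nat
  | FoRel (R : rel_symb tau) of ('I_(arity R) -> term tau nat)
  | FoNot of fo_formula tau
  | FoAnd of fo_formula tau & fo_formula tau
  | FoOr of fo_formula tau & fo_formula tau
  | FoAll of nat & fo_formula tau
  | FoEx of nat & fo_formula tau.

Fixpoint fo_fv tau (phi : fo_formula tau) : set nat :=
  match phi with
  | FoEq t u => term_fv t `|` term_fv u
  | FoRel _ ts => \bigcup_i term_fv (ts i)
  | FoNot psi => fo_fv psi
  | FoAnd psi chi | FoOr psi chi => fo_fv psi `|` fo_fv chi
  | FoAll v psi | FoEx v psi => fo_fv psi `\ v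
  end.

Definition fo_sentence tau (phi : fo_formula tau) : Prop := fo_fv phi = set0.

Section FirstOrderSemantics.
Variables (tau : vocabulary) (A : structure tau).

Definition fo_term_val (s : nat -> A) (t : term tau nat) : A :=
  match t with Var v => s v | Const c => const_interp A c end.

Definition fo_update (s : nat -> A) (v : nat) (a : A) : nat -> A :=
  fun w => if v == w then a else s w.

Fixpoint fo_sat (s : nat -> A) (phi : fo_formula tau) : Prop :=
  match phi with
  | FoEq t u => fo_term_val s t = fo_term_val s u
  | FoRel _ ts => rel_interp (fun i => fo_term_val s (ts i))
  | FoNot psi => ~ fo_sat s psi
  | FoAnd psi chi => fo_sat s psi /\ fo_sat s chi
  | FoOr psi chi => fo_sat s psi \/ fo_sat s chi
  | FoAll v psi => forall a, fo_sat (fo_update s v a) psi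
  | FoEx v psi => exists a, fo_sat (fo_update s v a) psi
  end.

Definition fo_models (phi : fo_formula tau) : Prop :=
  forall s : nat -> A, fo_sat s phi.

End FirstOrderSemantics.

Definition D2_le_FO (tau : vocabulary) : Prop :=
  forall phi : formula tau, in_D2 phi -> sentence phi ->
    exists2 chi : fo_formula tau, fo_sentence chi &
      forall A : structure tau, models A phi <-> fo_models A chi.

(* Main.v *)
(** On the team of all assignments [x |-> a] with [a] in a set [S], a choice of
    values for [y] is a function [f] on [S], and [=(y, x)] says that [f] is
    injective. So "[forall x (~ P x \/ exists y (Q y /\ =(y, x)))]" says
    [|P| <= |Q|], and (a) follows by Cantor-Bernstein; replacing [Q y] by
    [y <> c] gives an injection of the domain into itself that misses [c], hence
    (b). A [k]-fold disjunction of [=(x)] covers the domain by [k] sets with at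
    most one element each, hence (c). Equicardinality is not first-order: by a
    back-and-forth argument, a structure in which [P] and [Q] are both countably
    infinite is elementarily equivalent to one in which [Q] is uncountable. *)

Require Import Defs.
From mathcomp Require Import all_boot.
From mathcomp Require Import classical_sets cardinality.
From mathcomp Require Import boolp functions.

Set Implicit Arguments.
Unset Strict Implicit.
Unset Printing Implicit Defensive.

Local Open Scope classical_set_scope.
Local Open Scope card_scope.

(** * Cardinal comparison by injections *)

Lemma card_le_injP T U (A : set T) (B : set U) : inhabited U ->
  A #<= B <->
  exists f : T -> U, (forall a, A a -> B (f a)) /\
    (forall a b, A a -> A b -> f a = f b -> a = b).
Proof.
elim/Ppointed: U => U in B *; first by case=> u; have [] := no u.
move=> _; split=> [/pcard_leP[f]|[f [fAB f_inj]]].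
  exists f; split=> [a Aa|a b Aa Ab]; first exact: funS.
  by apply: inj; rewrite inE.
apply/pcard_leP/injfunPex; exists f => // a b /set_mem Aa /set_mem Ab.
exact: f_inj.
Qed.

Lemma not_card_le_powerset T : inhabited T -> ~ ([set: set T] #<= [set: T]).
Proof.
move=> /card_le_injP -> [f [_ f_inj]].
(* Cantor's diagonal: the codes [f X] that lie outside the set [X] they code. *)
pose D := [set x | exists X, f X = x /\ ~ X x].
have nD : ~ D (f D).
  by move=> DfD; have [X [/(f_inj _ _ I I) XD]] := DfD; rewrite XD.
by case: (nD); exists D.
Qed.

(** Hilbert's hotel. An infinite type has an injective sequence [e] with [e 0 = x], and [f] shifts
    it by one and fixes all other points. Conversely, the iterates of [x] under an injection that
    misses [x] are pairwise distinct. *)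
Lemma infinite_setT_injP T (x : T) :
  infinite_set [set: T] <->
  exists f : T -> T, (forall a, f a <> x) /\ injective f.
Proof.
split=> [Tinf|[f [fx f_inj]]].
  have /infiniteP : infinite_set ([set: T] `\ x) by apply: infinite_setD.
  rewrite card_le_injP; last exact: inhabits.
  move=> [h [hx h_inj]]; pose e n := if n is m.+1 then h m else x.
  have e_inj : injective e.
    move=> [|m] [|n] //= => [xh|hx'|/h_inj ->] //.
      by have [_ []] := hx n I.
    by have [_ []] := hx m I.
  pose f a := if pselect (exists n, e n = a) is left en
    then e (projT1 (cid en)).+1 else a.
  exists f; rewrite /f; split=> [a|a b].
    case: pselect => [en|nea xa]; last by apply: nea; exists 0.
    by move=> /(e_inj _ 0).
  case: pselect => [ea|nea]; case: pselect => [eb|neb] //.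
  - case: (cid ea) (cid eb) => m ma [n nb] /= mn.
    by have [mn'] := e_inj m.+1 n.+1 mn; rewrite -ma -nb mn'.
  - by move=> eb; case: neb; eexists; exact: eb.
  - by move=> ea; case: nea; eexists; exact/esym/ea.
rewrite infiniteP card_le_injP; last exact: inhabits.
exists (fun n => iter n f x); split=> // m n _ _.
elim: m n => [|m IH] [|n] //=; first by move=> /esym/fx.
  by move=> /fx.
by move=> /f_inj/IH ->.
Qed.

(** * Teams on [x], and graphs of functions *)

Section OneVariableTeams.
Variables (tau : vocabulary) (A : structure tau).
Implicit Types (S : set A) (f : A -> A).

Definition assign_x (a : A) : assignment A := update (@empty_assignment A) vx a.

Definition graph_assign f (a : A) : assignment A := update (assign_x a) vy (f a).

Lemma duplicate_empty_assignment :
  duplicate [set @empty_assignment A] vx = range assign_x.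
Proof.
apply/seteqP; split=> s /= => [[_ [a [-> ->]]]|[a _ <-]]; first by exists a.
by exists (@empty_assignment A), a.
Qed.

Lemma models_All_x (psi : formula tau) :
  models A (All vx psi) <-> team_sat (range assign_x) psi.
Proof. by rewrite -duplicate_empty_assignment. Qed.

(** An assignment of this team is determined by its value at [x], so a choice function on the team
    is the same as a function on [S]. This removes the subtype [set_type] from all later
    arguments. *)
Lemma team_sat_Ex_y S (psi : formula tau) :
  team_sat (assign_x @` S) (Ex vy psi) <->
  exists f, team_sat (graph_assign f @` S) psi.
Proof.
have [d] := dom_inhabited A.
split=> /= [[F]|[f]].
  (* The default [d] is used only for elements whose assignment is outside the team. *)
  pose f a := if insub (assign_x a) is Some s then F s else d.
  suff <- : graph_assign f @` S = supplement vy F by exists f.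
  apply/seteqP; split=> s /= => [[a Sa <-]|[[t tS] _ <-]].
    have aS : assign_x a \in assign_x @` S by rewrite inE; exists a.
    by exists (Sub (assign_x a) aS) => //; rewrite /graph_assign /f insubT.
  have [a Sa at_] := set_mem tS; exists a => //.
  by rewrite /graph_assign /f; case: insubP => [[u uS] _ /= ut|];
    rewrite at_ ?tS //; congr update; congr F; apply/val_inj; rewrite /= ut.
(* The value of [x] is read off [s]; the default [d] is never reached, as [x] is defined throughout
   the team. *)
pose F (s : set_type (assign_x @` S)) := if val s vx is Some a then f a else d.
suff <- : supplement vy F = graph_assign f @` S by exists F.
apply/seteqP; split=> s /= => [[[t tS] _ <-]|[a Sa <-]].
  by have [a Sa at_] := set_mem tS; exists a; rewrite // /F /= -at_.
have aS : assign_x a \in assign_x @` S by rewrite inE; exists a.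
by exists (Sub (assign_x a) aS).
Qed.

Lemma team_sat_Dep2_graph S f :
  team_sat (graph_assign f @` S) (Dep2 (Var vy) (Var vx) : formula tau) <->
  forall a b, S a -> S b -> f a = f b -> a = b.
Proof.
split=> [/= D a b Sa Sb fab|f_inj _ _ [a Sa <-] [b Sb <-] [fab]] /=.
  have := D (graph_assign f a) (graph_assign f b) (imageP _ Sa) (imageP _ Sb).
  by move=> /(_ (congr1 some fab)) [].
by congr Some; exact: f_inj.
Qed.

End OneVariableTeams.

(** * The sentence for equal cardinality *)

Section Equicardinality.
Variables (tau : vocabulary).
Implicit Types P Q : rel_symb tau.

Definition injects_into_formula Q : formula tau :=
  Ex vy (And (@Rel tau Q (fun=> Var vy)) (Dep2 (Var vy) (Var vx))).

Definition card_le_formula P Q : formula tau :=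
  All vx (Or (@NRel tau P (fun=> Var vx)) (injects_into_formula Q)).

Lemma sentence_card_le_formula P Q : sentence (card_le_formula P Q).
Proof.
apply/seteqP; split=> // -[] /=; first by case=> _; apply.
by case=> -[[i _ []]|[_ []]].
Qed.

Lemma rel_interp_unary (A : structure tau) P (a : 'I_(arity P) -> A) (b : A) :
  (forall i, Some b = Some (a i)) -> rel_interp a <-> unary_ext A P b.
Proof.
move=> ab; rewrite /unary_ext /= (_ : a = fun=> b) //.
by apply/funext => i; have [] := ab i.
Qed.

Lemma models_card_le_formula (A : structure tau) P Q :
  models A (card_le_formula P Q) <-> unary_ext A P #<= unary_ext A Q.
Proof.
rewrite card_le_injP; last exact: dom_inhabited.
rewrite models_All_x; split.
  move=> [Y [Z [XYZ satY satZ]]].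
  (* As a part of the team of all [assign_x a], [Z] is the image of a set of elements, the form
     required by [team_sat_Ex_y]. *)
  have ZE : Z = @assign_x tau A @` [set a | Z (assign_x a)].
    apply/seteqP; split=> [s Zs|_ [a Za <-]//].
    have : range (@assign_x tau A) s by rewrite XYZ; right.
    by move=> [a _ sa]; exists a; rewrite /= ?sa.
  have : team_sat Z (injects_into_formula Q) by [].
  rewrite ZE => /team_sat_Ex_y[f [fQ /team_sat_Dep2_graph f_inj]].
  (* An assignment in [Y] sends [x] outside [P], so the elements of [P] must all be covered by
     [Z]. *)
  have PZ a : unary_ext A P a -> Z (assign_x a).
    move=> Pa; have : (Y `|` Z) (assign_x a) by rewrite -XYZ; exists a.
    by case=> // /satY[b ba]; rewrite (rel_interp_unary ba) => /(_ Pa).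
  exists f; split=> [a /PZ Za|a b /PZ Za /PZ Zb]; last exact: f_inj.
  by have [b ba] := fQ _ (imageP (graph_assign f) Za); rewrite (rel_interp_unary ba).
move=> [f [fPQ f_inj]].
(* Split the team along [P] itself. *)
exists (@assign_x tau A @` ~` unary_ext A P), (@assign_x tau A @` unary_ext A P).
split.
- by rewrite -image_setU setUC setUv.
- by move=> _ [a nPa <-]; exists (fun=> a).
- apply/team_sat_Ex_y; exists f; split; last exact/team_sat_Dep2_graph.
  by move=> _ [a Pa <-]; exists (fun=> f a) => //; exact: fPQ.
Qed.

Definition equicardinal_formula P Q : formula tau :=
  And (card_le_formula P Q) (card_le_formula Q P).

Lemma models_equicardinal_formula (A : structure tau) P Q :
  models A (equicardinal_formula P Q) <-> unary_ext A P #= unary_ext A Q.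
Proof.
rewrite card_eqPle -(models_card_le_formula A P Q).
by rewrite -(models_card_le_formula A Q P).
Qed.

Lemma sentence_equicardinal_formula P Q : sentence (equicardinal_formula P Q).
Proof.
rewrite /sentence -[fv _]/(fv (card_le_formula P Q) `|` fv (card_le_formula Q P)).
by rewrite !sentence_card_le_formula setU0.
Qed.

End Equicardinality.

(** * First-order equivalence by back-and-forth *)

Section FirstOrder.
Variable tau : vocabulary.

Lemma fo_sat_fv (A : structure tau) (phi : fo_formula tau) (s t : nat -> A) :
  (forall i, fo_fv phi i -> s i = t i) -> fo_sat s phi <-> fo_sat t phi.
Proof.
have val_fv (u : term tau nat) (s' t' : nat -> A) :
    (forall i, term_fv u i -> s' i = t' i) -> fo_term_val s' u = fo_term_val t' u.
  by case: u => //= v; apply.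
elim: phi s t => /= [u v|R us|psi IH|psi IH chi IH'|psi IH chi IH'
                     |v psi IH|v psi IH] s t st.
- by rewrite (val_fv u s t) ?(val_fv v s t) // => i ?; apply: st; [right|left].
- rewrite (_ : (fun i => fo_term_val s (us i)) = (fun i => fo_term_val t (us i))) //.
  by apply/funext => i; apply: val_fv => j ?; apply: st; exists i.
- by rewrite (IH s t).
- by rewrite (IH s t) ?(IH' s t) // => i ?; apply: st; [right|left].
- by rewrite (IH s t) ?(IH' s t) // => i ?; apply: st; [right|left].
- have stv a : fo_sat (fo_update s v a) psi <-> fo_sat (fo_update t v a) psi.
    apply: IH => i psi_i; rewrite /fo_update; case: eqP => // vi.
    by apply: st; split=> // /esym.
  by split=> H a; apply/stv/H.
- have stv a : fo_sat (fo_update s v a) psi <-> fo_sat (fo_update t v a) psi.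
    apply: IH => i psi_i; rewrite /fo_update; case: eqP => // vi.
    by apply: st; split=> // /esym.
  by split=> -[a H]; exists a; apply/stv.
Qed.

Lemma fo_models_sentence (A : structure tau) (phi : fo_formula tau) (s : nat -> A) :
  fo_sentence phi -> fo_models A phi <-> fo_sat s phi.
Proof.
move=> phi0; split=> [|sphi t]; first exact.
by rewrite (@fo_sat_fv _ _ t s) // phi0.
Qed.

(** A family of partial isomorphisms given by their graphs: [baf_eq] makes each graph single-valued
    and injective. Each graph contains the pairs of constants, so the values of terms stay within
    it. *)
Record back_and_forth (A B : structure tau) (I : set (set (A * B))) : Prop := {
  baf_eq : forall p a a' b b', I p -> p (a, b) -> p (a', b') -> a = a' <-> b = b';
  baf_const : forall p c, I p -> p (const_interp A c, const_interp B c);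
  baf_rel : forall p R (a : 'I_(arity R) -> A) (b : 'I_(arity R) -> B), I p ->
    (forall i, p (a i, b i)) -> rel_interp a <-> rel_interp b;
  baf_forth : forall p a, I p -> exists q b, [/\ I q, p `<=` q & q (a, b)];
  baf_back : forall p b, I p -> exists q a, [/\ I q, p `<=` q & q (a, b)]
}.

(** Induction on [phi] with [p], [s], [t] general: a quantifier changes one value on each side, and
    [p] is enlarged to contain the new pair. *)
Lemma fo_sat_back_and_forth (A B : structure tau) (I : set (set (A * B)))
    (phi : fo_formula tau) (p : set (A * B)) (s : nat -> A) (t : nat -> B) :
  back_and_forth I -> I p -> (forall i, p (s i, t i)) ->
  fo_sat s phi <-> fo_sat t phi.
Proof.
move=> bafI.
have val_p (u : term tau nat) p' s' t' : I p' -> (forall i, p' (s' i, t' i)) ->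
    p' (fo_term_val s' u, fo_term_val t' u).
  by move=> Ip' st; case: u => [v|c] /=; [exact: st | exact: (baf_const bafI)].
have upd q a b v s' t' : q (a, b) -> (forall i, q (s' i, t' i)) ->
    forall i, q (fo_update s' v a i, fo_update t' v b i).
  by move=> qab st i; rewrite /fo_update; case: eqP.
elim: phi p s t => /= [u v|R us|psi IH|psi IH chi IH'|psi IH chi IH'
                       |v psi IH|v psi IH] p s t Ip st.
- by apply: (baf_eq bafI Ip); exact: val_p.
- by apply: (baf_rel bafI Ip) => i; exact: val_p.
- by rewrite (IH p s t).
- by rewrite (IH p s t) // (IH' p s t).
- by rewrite (IH p s t) // (IH' p s t).
- split=> [H b|H a].
    have [q [a [Iq pq qab]]] := baf_back bafI b Ip.
    by apply/(IH q (fo_update s v a)) => //; apply: upd => // i; apply: pq.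
  have [q [b [Iq pq qab]]] := baf_forth bafI a Ip.
  by apply/(IH q _ (fo_update t v b)) => //; apply: upd => // i; apply: pq.
- split=> [[a H]|[b H]].
    have [q [b [Iq pq qab]]] := baf_forth bafI a Ip.
    exists b; apply/(IH q (fo_update s v a)) => //.
    by apply: upd => // i; apply: pq.
  have [q [a [Iq pq qab]]] := baf_back bafI b Ip.
  exists a; apply/(IH q _ (fo_update t v b)) => //.
  by apply: upd => // i; apply: pq.
Qed.

Lemma fo_models_back_and_forth (A B : structure tau) (I : set (set (A * B)))
    (phi : fo_formula tau) :
  back_and_forth I -> I !=set0 -> fo_sentence phi ->
  fo_models A phi <-> fo_models B phi.
Proof.
move=> bafI [p0 Ip0] phi0; have [a] := dom_inhabited A.
(* One matched pair is enough: the constant assignments at [a] and [b] are then related by [p]. *)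
have [p [b [Ip _ pab]]] := baf_forth bafI a Ip0.
rewrite (fo_models_sentence (fun=> a) phi0) (fo_models_sentence (fun=> b) phi0).
exact: (fo_sat_back_and_forth _ bafI Ip).
Qed.

End FirstOrder.

(** * Structures separating equicardinality from first-order logic *)

Section TwoSorted.
Variables (tau : vocabulary) (P Q : rel_symb tau).

(** [P] lives on the countable sort [nat] and [Q] on the sort [T]. Other relations are empty and all
    constants denote [inl 0], so preserving sorts preserves every relation. *)
Definition two_sorted (T : Type) : structure tau :=
  @Structure tau (nat + T) (inhabits (inl 0))
    (fun R a => (R = P /\ forall i, is_inl (a i)) \/
                (R = Q /\ forall i, ~~ is_inl (a i)))
    (fun=> inl 0).

(** The pair [(inl 0, inl 0)] is required because it interprets every constant. *)
Definition finite_partial_iso T U : set (set (two_sorted T * two_sorted U)) :=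
  [set p | [/\ finite_set p, p (inl 0, inl 0),
    forall a b, p (a, b) -> is_inl a = is_inl b &
    forall a a' b b', p (a, b) -> p (a', b') -> a = a' <-> b = b']].

Lemma finite_partial_iso_forth T U p (a : two_sorted T) :
  infinite_set [set: U] -> finite_partial_iso p ->
  exists q (b : two_sorted U), [/\ finite_partial_iso q, p `<=` q & q (a, b)].
Proof.
move=> Uinf [pfin p0 psort piso].
have [[b pab]|npa] := pselect (exists b, p (a, b)).
  by exists p, b; split.
(* The sort of [a] is infinite on the other side, while [p] uses only finitely many points there;
   this leaves a fresh partner for [a]. *)
have sort_inf : infinite_set [set b : two_sorted U | is_inl a = is_inl b].
  case: {npa} a => x.
    apply: (@sub_infinite_set _ (range (@inl nat U))); first by move=> _ [y _ <-].
    by rewrite infiniteP (card_le_eqr (inj_card_eq _)) // => y z _ _ [].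
  apply: (@sub_infinite_set _ (range (@inr nat U))); first by move=> _ [y _ <-].
  rewrite infiniteP (card_le_eqr (inj_card_eq _)); last by move=> y z _ _ [].
  exact/infiniteP.
have /infinite_setN0[b [ab npb]] :=
  infinite_setD sort_inf (finite_image snd pfin).
exists (p `|` [set (a, b)]), b; split; [|by left|by right].
have fresh_a a' b' : p (a', b') -> a' <> a.
  by move=> pab' aa; apply: npa; exists b'; rewrite -aa.
have fresh_b a' b' : p (a', b') -> b' <> b.
  by move=> pab' bb; apply: npb; exists (a', b').
split; first by rewrite finite_setU.
- by left.
- by move=> a' b' [/psort //|[-> ->]].
- move=> a1 a2 b1 b2 [p1|[-> ->]] [p2|[-> ->]] //.
  + exact: piso.
  + by split=> [/(fresh_a _ _ p1)|/(fresh_b _ _ p1)].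
  + by split=> /esym => [/(fresh_a _ _ p2)|/(fresh_b _ _ p2)].
Qed.

(** By this symmetry the back step follows from the forth step. *)
Lemma finite_partial_iso_swap T U (p : set (two_sorted T * two_sorted U)) :
  finite_partial_iso p -> finite_partial_iso [set x | p (x.2, x.1)].
Proof.
move=> [pfin p0 psort piso]; split=> //=.
- apply: sub_finite_set (finite_image (fun x => (x.2, x.1)) pfin).
  by move=> [a b] /= pab; exists (b, a).
- by move=> a b /psort.
- by move=> a a' b b' p1 p2; split=> /(piso _ _ _ _ p1 p2).
Qed.

Lemma two_sorted_back_and_forth T U :
  infinite_set [set: T] -> infinite_set [set: U] ->
  back_and_forth (@finite_partial_iso T U).
Proof.
move=> Tinf Uinf; split.
- by move=> p a a' b b' [_ _ _]; apply.
- by move=> p c [].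
- move=> p R a b [_ _ psort _] pab.
  have ab i : is_inl (a i) = is_inl (b i) by exact: psort.
  by split=> /= -[] [RPQ H]; [left|right|left|right]; split=> // i;
    move: (H i); rewrite ab.
- by move=> p a; exact: finite_partial_iso_forth.
- move=> p b /finite_partial_iso_swap/(finite_partial_iso_forth b Tinf).
  move=> [q [a [/finite_partial_iso_swap Iq pq qba]]].
  by exists [set x | q (x.2, x.1)], a; split=> // -[x y] pxy; exact: pq.
Qed.

Lemma two_sorted_fo_equiv T U (phi : fo_formula tau) :
  infinite_set [set: T] -> infinite_set [set: U] -> fo_sentence phi ->
  fo_models (two_sorted T) phi <-> fo_models (two_sorted U) phi.
Proof.
move=> Tinf Uinf; apply: fo_models_back_and_forth.
  exact: two_sorted_back_and_forth.
exists [set (inl 0, inl 0)]; split=> //; try by move=> a b [-> ->].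
by move=> a a' b b' [-> ->] [-> ->].
Qed.

Hypotheses (arP : arity P = 1) (arQ : arity Q = 1) (PQ : P <> Q).

Lemma two_sorted_equicardinal T :
  unary_ext (two_sorted T) P #= unary_ext (two_sorted T) Q <->
  [set: nat] #= [set: T].
Proof.
have -> : unary_ext (two_sorted T) P = range (@inl nat T).
  apply/seteqP; split=> /= [[n|x] H|_ [n _ <-]]; [by exists n| |by left].
  (* Arity 1 provides the index [ord0] at which the sort of the tuple is read off. *)
  by case: H => [[_]|[/PQ//]]; rewrite arP => /(_ ord0).
have -> : unary_ext (two_sorted T) Q = range (@inr nat T).
  apply/seteqP; split=> /= [[n|x] H|_ [y _ <-]]; [|by exists x|by right].
  by case: H => [[/esym/PQ]//|[_]]; rewrite arQ => /(_ ord0).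
by rewrite (card_eql (inj_card_eq _)) ?(card_eqr (inj_card_eq _)) // => x y _ _ [].
Qed.

(** A first-order equivalent [chi] would hold over [T = nat], hence over [T = set nat], and so give
    a bijection between [nat] and its powerset, against Cantor. *)
Lemma not_D2_le_FO : ~ D2_le_FO tau.
Proof.
have nat_inf := infinite_nat.
have set_nat_inf : infinite_set [set: set nat].
  apply/infiniteP; apply/card_le_injP; first exact: (inhabits set0).
  exists (fun n => [set n]); split=> // a b _ _ /seteqP[+ _].
  by move=> /(_ a erefl).
move=> /(_ (equicardinal_formula P Q)) [] //.
  exact: sentence_equicardinal_formula.
move=> chi chi0 chiE; apply: (not_card_le_powerset (inhabits 0)).
suff /card_eqPle[] : [set: nat] #= [set: set nat] by [].
apply/two_sorted_equicardinal/models_equicardinal_formula/chiE.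
apply/(two_sorted_fo_equiv nat_inf set_nat_inf chi0)/chiE.
exact/models_equicardinal_formula/two_sorted_equicardinal.
Qed.

End TwoSorted.

(** * The sentence for infinite domains *)

Section Infinity.
Variables (tau : vocabulary) (c : const_symb tau).

Definition infinity_formula : formula tau :=
  All vx (Ex vy (And (NEq (Var vy) (Const c)) (Dep2 (Var vy) (Var vx)))).

Lemma sentence_infinity_formula : sentence infinity_formula.
Proof. by apply/seteqP; split=> // -[] /= [] []; tauto. Qed.

Lemma models_infinity_formula (A : structure tau) :
  models A infinity_formula <-> infinite_set [set: A].
Proof.
rewrite (infinite_setT_injP (const_interp A c)) models_All_x team_sat_Ex_y.
split=> [[f [fc /team_sat_Dep2_graph f_inj]]|[f [fc f_inj]]]; exists f.
  split=> [a fa|a b fab]; last exact: f_inj.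
  have Aa : [set: A] a by [].
  exact: (fc _ (imageP (graph_assign f) Aa) (congr1 some fa)).
split; last by apply/team_sat_Dep2_graph => a b _ _ /f_inj.
by move=> _ [a _ <-] [/fc].
Qed.

End Infinity.

(** * The sentences bounding the size of the domain *)

Section AtMost.
Variable tau : vocabulary.

(* The disjunction of [k.+1] copies of [=(x)]. *)
Fixpoint at_most_formula (k : nat) : formula tau :=
  if k is k'.+1 then Or (Dep1 (Var vx)) (at_most_formula k')
  else Dep1 (Var vx).

Lemma in_D1_at_most_formula k : in_D1 (All vx (at_most_formula k)).
Proof. by split=> //; elim: k. Qed.

Lemma sentence_at_most_formula k : sentence (All vx (at_most_formula k)).
Proof.
suff fvE : fv (at_most_formula k) = [set vx] by rewrite /sentence /= fvE setDv.
by elim: k => //= k ->; rewrite setUid.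
Qed.

(** Splitting the team among the disjuncts amounts to colouring it with [k.+1] colours such that [x]
    is constant on each colour class. *)
Lemma team_sat_at_most (A : structure tau) k (X : team A) :
  team_sat X (at_most_formula k) <->
  exists f : assignment A -> nat, (forall s, X s -> f s < k.+1) /\
    (forall s t, X s -> X t -> f s = f t -> s vx = t vx).
Proof.
elim: k X => [|k IH] X.
  split=> [/= D|[f [f1 f_inj]] s t Xs Xt /=].
    by exists (fun=> 0); split=> // s t Xs Xt _; exact: D.
  apply: f_inj => //.
  by move: (f1 _ Xs) (f1 _ Xt); rewrite !ltnS !leqn0 => /eqP -> /eqP ->.
split=> [/= [Y [Z [-> satY /IH[f [fk f_inj]]]]]|[f [fk f_inj]]].
  (* [Y] and [Z] may overlap: [Z] keeps its colours, and the new colour [k.+1] goes to what lies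
     outside [Z], which is within [Y]. *)
  exists (fun s => if pselect (Z s) then f s else k.+1); split=> [s|s t].
    by case: pselect => // Zs _; apply/ltnW/fk.
  case: pselect => Zs; case: pselect => Zt Xs Xt.
  - exact: f_inj.
  - by move=> /= fsk; have := fk _ Zs; rewrite fsk ltnn.
  - by move=> /= fsk; have := fk _ Zt; rewrite -fsk ltnn.
  - by case: Xs => // Ys; case: Xt => // Yt _; exact: satY.
exists (X `&` [set s | f s = k.+1]), (X `&` [set s | f s <> k.+1]); split.
- by rewrite -setIUr (_ : _ `|` _ = setT) ?setIT // setUv.
- by move=> s t [Xs fs] [Xt ft]; apply: f_inj; rewrite // fs ft.
- apply/IH; exists f; split=> [s [Xs /eqP fs]|s t [Xs _] [Xt _]]; last exact: f_inj.
  by rewrite ltn_neqAle fs -ltnS fk.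
Qed.

Lemma models_at_most_formula (A : structure tau) k :
  models A (All vx (at_most_formula k)) <-> [set: A] #<= `I_k.+1.
Proof.
rewrite card_le_injP; last exact: (inhabits 0).
rewrite models_All_x team_sat_at_most.
split=> [[f [fk f_inj]]|[f [fk f_inj]]].
  exists (fun a => f (assign_x a)); split=> [a _|a b _ _ fab].
    by apply: fk; exists a.
  have [] // : Some a = Some b.
  by apply: (f_inj (assign_x a) (assign_x b)).
have [d] := dom_inhabited A.
exists (fun s => f (odflt d (s vx))); split=> [_ [a _ <-]|_ _ [a _ <-] [b _ <-]].
  exact: fk.
by move=> /= /f_inj ->.
Qed.

End AtMost.

Theorem proposition3p4 :
  (* (a) *)
  (forall (tau : vocabulary) (P Q : rel_symb tau),
     arity P = 1 -> arity Q = 1 ->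
     (exists phi : formula tau,
        [/\ in_D2 phi, sentence phi &
          forall A : structure tau,
            models A phi <-> unary_ext A P #= unary_ext A Q]) /\
     (P <> Q -> ~ D2_le_FO tau)) /\
  (* (b) *)
  (forall (tau : vocabulary) (c : const_symb tau),
     exists psi : formula tau,
       [/\ in_D2_with c psi, sentence psi &
         forall A : structure tau,
           models A psi <-> infinite_set [set: A]]) /\
  (* (c) *)
  (forall (tau : vocabulary) (k : nat), 0 < k ->
     exists theta : formula tau,
       [/\ in_D1 theta, sentence theta &
         forall A : structure tau,
           models A theta <-> [set: A] #<= `I_k]).
Proof.
split; [|split].
- move=> tau P Q arP arQ; split; last exact: not_D2_le_FO.
  exists (equicardinal_formula P Q); split=> //.
    exact: sentence_equicardinal_formula.
  by move=> A; exact: models_equicardinal_formula.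
- move=> tau c; exists (infinity_formula c); split=> //.
  + exact: sentence_infinity_formula.
  + exact: models_infinity_formula.
(* Index [k] gives [k.+1] disjuncts, hence the shift by one from the positive bound. *)
- move=> tau [//|k] _; exists (All vx (at_most_formula tau k)); split.
  + exact: in_D1_at_most_formula.
  + exact: sentence_at_most_formula.
  + by move=> A; exact: models_at_most_formula.
Qed.
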